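(* Consider an All-Against-One (AAO) linear quadratic differential game with $M$ players on $[t_0,t_f]$ with a solution set $\{S_i(t),\ i=1,\dots,M\}$ satisfying the coupled Riccati differential equations of the game on $[t_0,t_f]$, with $S_i(t_f)=S_{if}$. Suppose $Q_1+\sum_{i=2}^MQ_i>0$ and $S_{1f}+\sum_{i=2}^MS_{if}>0$. Then the state trajectory $x$ of $$\dot x=\Big(A-\sum_{j=1}^MH_jS_j\Big)x,\qquad x(t_0)=x_0,$$ is exponentially bounded. In particular, for any $r>0$ (however small), $\|x(t_f)\|\le r$ provided that $$t_f-t_0\ \ge\ \frac{\overline\lambda_P}{\underline\lambda_{\widehat Q}}\left\{2\ln\left(\frac{\|x_0\|}{r}\right)+\ln\left(\frac{\overline\lambda_P}{\underline\lambda_P}\right)\right\},$$ where $P(t)=S_1(t)+\sum_{i=2}^MS_i(t)$ and $\widehat Q=\sum_{i=1}^MQ_i$.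
   Context: For symmetric matrices, $>0,\ \ge 0,\ <0,\ \le 0$ mean positive definite, positive semidefinite, negative definite, negative semidefinite. $\|\cdot\|$ on vectors is the Euclidean norm. For a symmetric matrix function $N(t)$ on $[t_0,t_f]$, $\overline\lambda_N=\max_{t\in[t_0,t_f]}\lambda^{\max}_N(t)$ and $\underline\lambda_N=\min_{t\in[t_0,t_f]}\lambda^{\min}_N(t)$, where $\lambda_N^{\max}(t),\lambda_N^{\min}(t)$ are the largest and smallest eigenvalues of $N(t)$; these extrema are assumed attained for $N=\widehat Q$. ''Exponentially bounded'' means that there are constants $c,k>0$ with $\|x(t)\|\le c\,e^{-k(t-t_0)}\|x_0\|$ for all $t\in[t_0,t_f]$. The initial state satisfies $x_0\neq 0$. AAO game: $M\ge 2$ players, time interval $[t_0,t_f]$, dynamics $\dot x=Ax+\sum_{j=1}^M B_ju_j$, $x(t_0)=x_0$, $x(t)\in\mathbb R^n$, and cost functions $J_i=\tfrac12 x^\intercal(t_f)S_{if}x(t_f)+\tfrac12\int_{t_0}^{t_f}[x^\intercal Q_ix+u_i^\intercal R_iu_i]\,dt$. The real matrices $A,B_i,Q_i,R_i$ (of proper dimensions) may depend on $t\in[t_0,t_f]$ and are bounded and piecewise continuous; $Q_i,R_i,S_{if}$ are symmetric; $R_i>0$ for $i=1,\dots,M$; $S_{1f}<0$ and $Q_1<0$; $S_{if}\ge0$ and $Q_i\ge0$ for $i=2,\dots,M$. Put $H_i=B_iR_i^{-1}B_i^\intercal$, assumed bounded. Coupled Riccati equations of the game: for $i=1,\dots,M$,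 $$\dot S_i+S_iA+A^\intercal S_i+Q_i+S_iH_iS_i-\sum_{j=1}^M\big(S_iH_jS_j+S_jH_jS_i\big)=0,\qquad S_i(t_f)=S_{if}.$$ A solution set over an interval consists of continuous, piecewise continuously differentiable $n\times n$ symmetric matrix functions satisfying these equations (except possibly at finitely many points) together with the boundary conditions. The state trajectory above is the one resulting from the closed-loop Nash strategies $u_i^*=-R_i^{-1}B_i^\intercal S_ix$. *)

(* Defs.v *)
From HB Require Import structures.
From mathcomp Require Import all_boot all_order all_algebra.
From mathcomp Require Import all_classical all_reals all_analysis.

Set Implicit Arguments.
Unset Strict Implicit.
Unset Printing Implicit Defensive.

Import Order.TTheory GRing.Theory Num.Theory.
Import numFieldNormedType.Exports.

Local Open Scope classical_set_scope.
Local Open Scope ring_scope.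

(* The library norm `|v| on matrices is the maximum norm, hence this one. *)
Definition enorm (R : realType) (n : nat) (v : 'cV[R]_n) : R :=
  Num.sqrt (\sum_(i < n) v i ord0 ^+ 2).

Definition qform (R : realType) (n : nat) (N : 'M[R]_n) (v : 'cV[R]_n) : R :=
  (v^T *m N *m v) ord0 ord0.

Definition symmx (R : realType) (n : nat) (N : 'M[R]_n) : Prop := N^T = N.

Definition posdefmx (R : realType) (n : nat) (N : 'M[R]_n) : Prop :=
  symmx N /\ forall v : 'cV[R]_n, v != 0 -> 0 < qform N v.

Definition possemidefmx (R : realType) (n : nat) (N : 'M[R]_n) : Prop :=
  symmx N /\ forall v : 'cV[R]_n, 0 <= qform N v.

Definition negdefmx (R : realType) (n : nat) (N : 'M[R]_n) : Prop :=
  symmx N /\ forall v : 'cV[R]_n, v != 0 -> qform N v < 0.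

(* For N symmetric of positive order the set of eigenvalues is finite and
   nonempty, so that this sup and this inf are a maximum and a minimum. *)
Definition eigmax (R : realType) (n : nat) (N : 'M[R]_n) : R :=
  sup [set a | eigenvalue N a].

Definition eigmin (R : realType) (n : nat) (N : 'M[R]_n) : R :=
  inf [set a | eigenvalue N a].

(* These are the maximum and the minimum over [t0, tf] whenever the latter
   exist (see eig_extrema_attained; for continuous N they always do). *)
Definition eigmax_over (R : realType) (n : nat) (t0 tf : R)
    (N : R -> 'M[R]_n) : R :=
  sup [set eigmax (N t) | t in `[t0, tf]].

Definition eigmin_over (R : realType) (n : nat) (t0 tf : R)
    (N : R -> 'M[R]_n) : R :=
  inf [set eigmin (N t) | t in `[t0, tf]].

Definition eig_extrema_attained (R : realType) (n : nat) (t0 tf : R)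
    (N : R -> 'M[R]_n) : Prop :=
  (exists2 t, t \in `[t0, tf] &
     forall s, s \in `[t0, tf] -> eigmax (N s) <= eigmax (N t)) /\
  (exists2 t, t \in `[t0, tf] &
     forall s, s \in `[t0, tf] -> eigmin (N t) <= eigmin (N s)).

(* Finitely many discontinuities, with finite one-sided limits everywhere;
   the values at the discontinuities and at the end points are arbitrary. *)
Definition pw_continuous (R : realType) (p q : nat) (t0 tf : R)
    (f : R -> 'M[R]_(p, q)) : Prop :=
  [/\ exists E : seq R, forall t, t \in `]t0, tf[ -> t \notin E ->
        {for t, continuous f},
      forall t, t \in `[t0, tf[ -> cvg (f s @[s --> t^'+]) &
      forall t, t \in `]t0, tf] -> cvg (f s @[s --> t^'-])].

(* 'D_1 f has a junk value at the points where f is not derivable; since those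
   are finitely many, it does not affect piecewise continuity. *)
Definition pw_C1 (R : realType) (p q : nat) (t0 tf : R)
    (f : R -> 'M[R]_(p, q)) : Prop :=
  (exists E : seq R, forall t, t \in `]t0, tf[ -> t \notin E ->
     derivable f t 1) /\
  pw_continuous t0 tf ('D_1 f).

(* Data of the game  x' = A x + \sum_j B_j u_j,  x(t0) = x0,  in which player i
   (with control u_i of dimension m i) minimizes
     J_i = 1/2 x(tf)^T S_if x(tf) + 1/2 \int_t0^tf (x^T Q_i x + u_i^T R_i u_i).
   Only the values of the coefficients on [t0, tf] are meaningful. *)
Record lq_game (R : realType) (M n : nat) (m : 'I_M -> nat) := LQGame {
  tini : R;
  tfin : R;
  xini : 'cV[R]_n;
  dynA : R -> 'M[R]_n;
  inpB : forall i : 'I_M, R -> 'M[R]_(n, m i);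
  wgtQ : 'I_M -> R -> 'M[R]_n;
  wgtR : forall i : 'I_M, R -> 'M[R]_(m i);
  trmS : 'I_M -> 'M[R]_n
}.

Definition gameH (R : realType) (M n : nat) (m : 'I_M -> nat)
    (G : lq_game R n m) (i : 'I_M) (t : R) : 'M[R]_n :=
  inpB G i t *m invmx (wgtR G i t) *m (inpB G i t)^T.

(* Players 1, ..., M are indexed by 0, ..., M - 1. *)
Definition player1 (M : nat) (hM : (2 <= M)%N) : 'I_M := Ordinal (ltnW hM).

Record is_AAO_game (R : realType) (M n : nat) (m : 'I_M -> nat)
    (hM : (2 <= M)%N) (G : lq_game R n m) : Prop := IsAAOGame {
  aao_time : tini G < tfin G;
  aao_xini : xini G != 0;
  aao_A : [bounded dynA G t | t in `[tini G, tfin G]] /\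
          pw_continuous (tini G) (tfin G) (dynA G);
  aao_B : forall i, [bounded inpB G i t | t in `[tini G, tfin G]] /\
          pw_continuous (tini G) (tfin G) (inpB G i);
  aao_Q : forall i, [bounded wgtQ G i t | t in `[tini G, tfin G]] /\
          pw_continuous (tini G) (tfin G) (wgtQ G i);
  aao_R : forall i, [bounded wgtR G i t | t in `[tini G, tfin G]] /\
          pw_continuous (tini G) (tfin G) (wgtR G i);
  aao_H : forall i, [bounded gameH G i t | t in `[tini G, tfin G]];
  aao_Rpos : forall i t, t \in `[tini G, tfin G] -> posdefmx (wgtR G i t);
  aao_S1 : negdefmx (trmS G (player1 hM));
  aao_Q1 : forall t, t \in `[tini G, tfin G] -> negdefmx (wgtQ G (player1 hM) t);
  aao_Si : forall i, i != player1 hM -> possemidefmx (trmS G i);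
  aao_Qi : forall i t, i != player1 hM -> t \in `[tini G, tfin G] ->
           possemidefmx (wgtQ G i t)
}.

Record riccati_solution (R : realType) (M n : nat) (m : 'I_M -> nat)
    (G : lq_game R n m) (S : 'I_M -> R -> 'M[R]_n) : Prop := RiccatiSolution {
  ric_sym : forall i t, t \in `[tini G, tfin G] -> symmx (S i t);
  ric_cont : forall i, {within `[tini G, tfin G], continuous (S i)};
  ric_pwC1 : forall i, pw_C1 (tini G) (tfin G) (S i);
  ric_eq : exists E : seq R, forall t, t \in `]tini G, tfin G[ -> t \notin E ->
    forall i, derivable (S i) t 1 /\
      'D_1 (S i) t + S i t *m dynA G t + (dynA G t)^T *m S i t + wgtQ G i t
      + S i t *m gameH G i t *m S i t
      - \sum_(j < M) (S i t *m gameH G j t *m S j t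
                      + S j t *m gameH G j t *m S i t) = 0;
  ric_final : forall i, S i (tfin G) = trmS G i
}.

(* x solves x' = (A - \sum_j H_j S_j) x, x(t0) = x0; the coefficients being
   only piecewise continuous, the equation may fail at finitely many points. *)
Record closed_loop_trajectory (R : realType) (M n : nat) (m : 'I_M -> nat)
    (G : lq_game R n m) (S : 'I_M -> R -> 'M[R]_n) (x : R -> 'cV[R]_n) : Prop :=
    ClosedLoopTrajectory {
  traj_cont : {within `[tini G, tfin G], continuous x};
  traj_ode : exists E : seq R,
    forall t, t \in `]tini G, tfin G[ -> t \notin E ->
    derivable x t 1 /\
    'D_1 x t = (dynA G t - \sum_(j < M) gameH G j t *m S j t) *m x t;
  traj_init : x (tini G) = xini G
}.

Definition exp_bounded (R : realType) (n : nat) (t0 tf : R)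
    (x : R -> 'cV[R]_n) : Prop :=
  exists c k : R, [/\ 0 < c, 0 < k &
    forall t, t \in `[t0, tf] ->
      enorm (x t) <= c * expR (- k * (t - t0)) * enorm (x t0)].

(* Main.v *)
(* Let P = S_1 + ... + S_M, let F be the closed-loop matrix and let
   W = Qhat + sum_i S_i H_i S_i, so that W >= Qhat > 0. Since the coupling terms
   of the Riccati equations are those of S_i F + F^T S_i, summing them over i
   yields P' = - (P F + F^T P) - W. Going backwards from
   P(t_f) > 0, this keeps P positive definite, so V = x^T P x is a Lyapunov
   function: V' = - x^T W x <= - (lambda_min(Qhat) / lambda_max(P)) V. *)
Require Import Defs.
From HB Require Import structures.
From mathcomp Require Import all_boot all_order all_algebra.
From mathcomp Require Import ring lra.
From mathcomp Require Import all_classical all_reals all_analysis.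

Import Order.TTheory GRing.Theory Num.Theory.
Import numFieldNormedType.Exports.

Set Implicit Arguments.
Unset Strict Implicit.

Local Open Scope classical_set_scope.
Local Open Scope ring_scope.

(** Each S_i H_i S_i is a congruence of H_i >= 0, hence nonnegative even where S_i is indefinite;
    this gives W >= Qhat. Qhat may jump, so its positivity at each time does not alone give a
    uniform lower bound: lambda comes from the attained minimum of its least eigenvalue. The
    obstacle is the positivity of P on the whole interval. The least eigenvalue is only shown to be
    Lipschitz in the matrix, and the differential equations may fail at finitely many times,
    possibly at the very time under study. So the eigenvalue is never differentiated: an eigenvector
    is frozen, and the mean value theorem is applied on a short interval free of exceptional times.
    The decay of V bounds the squared norm of x. Hence the square root of lambda_max(P) /
    lambda_min(P) and the halved rate in the exponential bound, and the factor 2 and the additional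
    logarithm in the time estimate. *)

(** * Quadratic forms and the Euclidean norm *)

Lemma qformE (R : realType) (n : nat) (N : 'M[R]_n) (v : 'cV[R]_n) :
  qform N v = \sum_j \sum_i v i ord0 * N i j * v j ord0.
Proof.
rewrite /qform mxE; apply: eq_bigr => j _; rewrite mxE mulr_suml.
by apply: eq_bigr => i _; rewrite mxE.
Qed.

Lemma qformD (R : realType) (n : nat) (N N' : 'M[R]_n) (v : 'cV[R]_n) :
  qform (N + N') v = qform N v + qform N' v.
Proof. by rewrite /qform mulmxDr mulmxDl mxE. Qed.

Lemma qformN (R : realType) (n : nat) (N : 'M[R]_n) (v : 'cV[R]_n) :
  qform (- N) v = - qform N v.
Proof. by rewrite /qform mulmxN mulNmx mxE. Qed.

Lemma qformZ (R : realType) (n : nat) (a : R) (N : 'M[R]_n) (v : 'cV[R]_n) :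
  qform (a *: N) v = a * qform N v.
Proof. by rewrite /qform -scalemxAr -scalemxAl mxE. Qed.

Lemma qform_sum (R : realType) (n : nat) (I : finType) (N : I -> 'M[R]_n)
    (v : 'cV[R]_n) :
  qform (\sum_i N i) v = \sum_i qform (N i) v.
Proof. by rewrite /qform mulmx_sumr mulmx_suml summxE. Qed.

Lemma qform_trmx (R : realType) (n : nat) (N : 'M[R]_n) (v : 'cV[R]_n) :
  qform N^T v = qform N v.
Proof.
rewrite /qform -[in RHS](trmxK (v^T *m N *m v)) [RHS]mxE.
by rewrite !trmx_mul trmxK mulmxA.
Qed.

Lemma qform_scale (R : realType) (n : nat) (N : 'M[R]_n) (a : R)
    (v : 'cV[R]_n) :
  qform N (a *: v) = a ^+ 2 * qform N v.
Proof.
rewrite /qform [(a *: v)^T]linearZ /= -!scalemxAl -scalemxAr scalerA mxE.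
by rewrite expr2.
Qed.

Lemma qform_mul (R : realType) (n p : nat) (N : 'M[R]_p) (A : 'M[R]_(p, n))
    (v : 'cV[R]_n) :
  qform (A^T *m N *m A) v = qform N (A *m v).
Proof. by rewrite /qform trmx_mul !mulmxA. Qed.

Lemma enorm_ge0 (R : realType) (n : nat) (v : 'cV[R]_n) : 0 <= enorm v.
Proof. exact: sqrtr_ge0. Qed.

Lemma enorm_sqr (R : realType) (n : nat) (v : 'cV[R]_n) :
  enorm v ^+ 2 = \sum_i v i ord0 ^+ 2.
Proof. by rewrite sqr_sqrtr//; apply: sumr_ge0 => i _; apply: sqr_ge0. Qed.

Lemma qform1 (R : realType) (n : nat) (v : 'cV[R]_n) :
  qform 1%:M v = enorm v ^+ 2.
Proof.
by rewrite /qform mulmx1 mxE enorm_sqr; apply: eq_bigr => i _; rewrite mxE expr2.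
Qed.

Lemma enorm_eq0 (R : realType) (n : nat) (v : 'cV[R]_n) :
  (enorm v == 0) = (v == 0).
Proof.
rewrite -sqrf_eq0 enorm_sqr psumr_eq0; last by move=> i _; apply: sqr_ge0.
apply/idP/eqP => [/allP h|->]; last first.
  by apply/allP => i _; rewrite mxE expr2 mul0r eqxx.
apply/colP => i; rewrite mxE; apply/eqP; rewrite -sqrf_eq0.
exact: (h i (mem_index_enum i)).
Qed.

Lemma enorm_gt0 (R : realType) (n : nat) (v : 'cV[R]_n) :
  (0 < enorm v) = (v != 0).
Proof. by rewrite lt_neqAle enorm_ge0 andbT eq_sym enorm_eq0. Qed.

Lemma enorm_scale (R : realType) (n : nat) (a : R) (v : 'cV[R]_n) :
  enorm (a *: v) = `|a| * enorm v.
Proof.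
apply/eqP; rewrite -(@eqrXn2 _ 2)// ?enorm_ge0//; last first.
  by rewrite mulr_ge0 ?enorm_ge0.
by rewrite -!qform1 qform_scale exprMn -qform1 real_normK ?num_real.
Qed.

Lemma mx_entry_le (R : realType) (m n : nat) (A : 'M[R]_(m, n)) i j :
  `|A i j| <= `|A|.
Proof.
by rewrite [leRHS]/Num.Def.normr/= mx_normrE; apply: (le_bigmax _ _ (i, j)).
Qed.

Lemma mulmx_norm_le (R : realType) (m n p : nat) (A : 'M[R]_(m, n))
    (B : 'M[R]_(n, p)) :
  `|A *m B| <= n%:R * (`|A| * `|B|).
Proof.
rewrite [leLHS]/Num.Def.normr/= mx_normrE bigmax_le//=.
case=> i j _ /=; rewrite mxE (le_trans (ler_norm_sum _ _ _))//.
rewrite mulr_natl -[X in _ *+ X]card_ord -sumr_const ler_sum// => k _.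
by rewrite normrM ler_pM// mx_entry_le.
Qed.

(** Each term is at most [|N|] times the mean of two squared coordinates; every coordinate occurs n
    times in each role, whence the factor n. Here [|N|] is the largest absolute entry. *)
Lemma qform_norm_le (R : realType) (n : nat) (N : 'M[R]_n) (v : 'cV[R]_n) :
  `|qform N v| <= n%:R * `|N| * enorm v ^+ 2.
Proof.
have b i j : `|v i ord0 * N i j * v j ord0|
    <= `|N| / 2 * (v i ord0 ^+ 2 + v j ord0 ^+ 2).
  rewrite !normrM mulrAC mulrC -mulrA ler_pM ?mx_entry_le//.
  rewrite -(real_normK (num_real (v i ord0))) -(real_normK (num_real (v j ord0))).
  have := sqr_ge0 (`|v i ord0| - `|v j ord0|); lra.
rewrite qformE (le_trans (ler_norm_sum _ _ _))//.
apply: (@le_trans _ _ (\sum_j \sum_i `|N| / 2 * (v i ord0 ^+ 2 + v j ord0 ^+ 2))).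
  apply: ler_sum => j _; rewrite (le_trans (ler_norm_sum _ _ _))//.
  exact: ler_sum.
under eq_bigr => j _ do
  rewrite -mulr_sumr big_split/= -enorm_sqr sumr_const card_ord.
rewrite -mulr_sumr big_split/= sumr_const card_ord.
rewrite sumrMnl -enorm_sqr -mulr_natl.
by rewrite le_eqVlt; apply/orP; left; apply/eqP; field.
Qed.

Lemma qform_addv (R : realType) (n : nat) (N : 'M[R]_n) (a : R)
    (v w : 'cV[R]_n) : symmx N ->
  qform N (v + a *: w)
  = qform N v + 2 * a * (w^T *m N *m v) ord0 ord0 + a ^+ 2 * qform N w.
Proof.
move=> sN; have e : (v^T *m N *m w) ord0 ord0 = (w^T *m N *m v) ord0 ord0.
  rewrite -[in RHS](trmxK (w^T *m N *m v)) [RHS]mxE.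
  by rewrite !trmx_mul trmxK sN mulmxA.
rewrite /qform [(v + _)^T]linearD /= [(a *: w)^T]linearZ /= !mulmxDl !mulmxDr.
rewrite -!scalemxAl -!scalemxAr.
have D (X Y : 'M[R]_1) : (X + Y) ord0 ord0 = X ord0 ord0 + Y ord0 ord0.
  by rewrite mxE.
have Z b (X : 'M[R]_1) : (b *: X) ord0 ord0 = b * X ord0 ord0 by rewrite mxE.
rewrite !D !Z e; ring.
Qed.

(** A zero of a nonnegative form is a minimum, so moving from v against N v cannot lower the
    form. *)
Lemma possemidef_null (R : realType) (n : nat) (N : 'M[R]_n) (v : 'cV[R]_n) :
  possemidefmx N -> qform N v = 0 -> N *m v = 0.
Proof.
move=> [sN N0] v0; set w := N *m v.
have e : (w^T *m N *m v) ord0 ord0 = enorm w ^+ 2.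
  by rewrite -qform1 /qform mulmx1 -mulmxA.
have c0 := N0 w.
set b := enorm w ^+ 2 in e; set c := qform N w in c0.
have c1 : 0 < c + 1 by lra.
(* The step length b / c would be optimal; c + 1 replaces c, which may vanish, and still leaves a
   negative multiple of b^2. *)
have := N0 (v + - (b / (c + 1)) *: w).
rewrite qform_addv// v0 e add0r -/c.
have -> : 2 * - (b / (c + 1)) * b + (- (b / (c + 1))) ^+ 2 * c
  = - ((b ^+ 2) * ((c + 2) / (c + 1) ^+ 2)).
  by field; rewrite gt_eqF.
rewrite oppr_ge0 pmulr_lle0; last by rewrite divr_gt0 ?exprn_gt0//; lra.
move=> b0; have /eqP : b ^+ 2 = 0 by apply/eqP; rewrite eq_le b0 sqr_ge0.
by rewrite /b !sqrf_eq0 enorm_eq0 => /eqP.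
Qed.

(** * Extreme eigenvalues of symmetric matrices and their continuity *)

Lemma coord_within_continuous (R : realType) (T : topologicalType) (D : set T)
    (m n : nat) (A : T -> 'M[R]_(m, n)) i j :
  {within D, continuous A} -> {within D, continuous (fun t => A t i j)}.
Proof.
move=> cA t; apply: (@continuous_comp (subspace D) _ _ A (fun B => B i j)).
  exact: cA.
exact: coord_continuous.
Qed.

Lemma qform_within_continuous (R : realType) (T : topologicalType) (D : set T)
    (n : nat) (N : T -> 'M[R]_n) (y : T -> 'cV[R]_n) :
  {within D, continuous N} -> {within D, continuous y} ->
  {within D, continuous (fun t => qform (N t) (y t))}.
Proof.
move=> cN cy; under eq_fun do rewrite qformE.
apply: continuous_big => [|j _]; first exact: add_continuous.
apply: continuous_big => [|i _ t]; first exact: add_continuous.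
apply: cvgM; last exact: (coord_within_continuous cy).
apply: cvgM; first exact: (coord_within_continuous cy).
exact: (coord_within_continuous cN).
Qed.

Lemma qform_sphere_min (R : realType) (n : nat) (N : 'M[R]_n) : (0 < n)%N ->
  exists2 v : 'cV[R]_n, enorm v = 1 &
    forall w, qform N v * enorm w ^+ 2 <= qform N w.
Proof.
move=> n0.
(* The compactness criterion and the extreme value theorem used below concern row vectors, so the
   unit sphere is transposed. *)
have cqT (D : set 'rV[R]_n) (B : 'M[R]_n) :
    {within D, continuous (fun u : 'rV[R]_n => qform B u^T)}.
  apply: qform_within_continuous; first exact/continuous_subspaceT/cst_continuous.
  apply: continuous_subspaceT => u A /= [e e0 eA].
  exists (fun i j => e j i) => [i j|w] /=.
    by have := e0 j i; rewrite mxE.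
  by move=> uw; apply: eA => i j; rewrite mxE.
pose D := [set u : 'rV[R]_n | enorm u^T = 1].
have D0 : D !=set0.
  exists (delta_mx ord0 (Ordinal n0)); rewrite /D /= trmx_delta.
  apply/eqP; rewrite -(@eqrXn2 _ 2)// ?enorm_ge0// enorm_sqr expr1n.
  rewrite (bigD1 (Ordinal n0))//= big1 ?addr0; last first.
    by move=> i ni; rewrite mxE (negbTE ni) expr0n.
  by rewrite mxE !eqxx expr1n.
have cD : compact D.
  apply: bounded_closed_compact.
    exists 1; split=> // a a1 u /= Du; apply: le_trans (ltW a1).
    rewrite [leLHS]/Num.Def.normr/= mx_normrE bigmax_le//=.
    case=> i j _; rewrite /= ord1 -(@ler_pXn2r _ 2)// ?nnegrE// expr1n.
    rewrite real_normK ?num_real// -(expr1n R 2) -Du enorm_sqr.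
    rewrite (bigD1 j)//= mxE lerDl; apply: sumr_ge0 => k _; exact: sqr_ge0.
  have -> : D = (fun u : 'rV[R]_n => qform 1%:M u^T) @^-1` [set 1].
    apply/seteqP; split => u; rewrite /D /= qform1; first by move->; rewrite expr1n.
    by move/eqP; rewrite sqrp_eq1 ?enorm_ge0// => /eqP.
  move/continuous_closedP: ((continuous_subspace_setT _).2 (cqT setT 1%:M)).
  by move=> c1; exact: (c1 [set 1] (@closed_eq R 1)).
have [u uD umin] := EVT_min_rV D0 cD (cqT D N).
rewrite inE in uD; exists u^T => // w.
(* The bound on the sphere extends to all w by homogeneity of degree 2; only the zero vector cannot
   be normalized. *)
have [->|w0] := eqVneq w 0.
  rewrite -(scale0r (0 : 'cV[R]_n)) enorm_scale qform_scale normr0 mul0r.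
  by rewrite !expr0n mul0r mulr0.
have ew : 0 < enorm w by rewrite enorm_gt0.
have := umin ((enorm w)^-1 *: w)^T.
rewrite trmxK qform_scale inE /D /= trmxK enorm_scale normfV (ger0_norm (enorm_ge0 w)).
rewrite mulVf ?gt_eqF// => /(_ erefl).
by rewrite exprVn mulrC ler_pdivlMr// exprn_gt0.
Qed.

(** Rayleigh's principle without Lagrange multipliers: if a is the minimum of the form on the unit
    sphere, reached at v, then N - a is positive semidefinite with a null form at v, so it kills v.
    Conversely an eigenvalue is the value of the form at a unit eigenvector, hence at least a.
    Eigenvectors in [eigenvalue] are rows, so symmetry is used to transpose. *)
Lemma eigmin_attained (R : realType) (n : nat) (N : 'M[R]_n) :
    (0 < n)%N -> symmx N ->
  exists v : 'cV[R]_n, [/\ enorm v = 1, N *m v = eigmin N *: v &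
    forall w, eigmin N * enorm w ^+ 2 <= qform N w].
Proof.
move=> n0 sN; have [v v1 vmin] := qform_sphere_min N n0.
set a := qform N v in vmin.
have sNa : possemidefmx (N - a *: 1%:M).
  split=> [|w]; first by rewrite /symmx linearB linearZ/= tr_scalar_mx sN.
  by rewrite qformD qformN qformZ qform1 subr_ge0.
have Nv : N *m v = a *: v.
  apply/eqP; rewrite -subr_eq0 -[X in a *: X]mul1mx scalemxAl -mulmxBl; apply/eqP.
  apply: possemidef_null => //.
  by rewrite qformD qformN qformZ qform1 v1 expr1n mulr1 subrr.
have aE : eigmin N = a; last by exists v; rewrite aE.
have v0 : v != 0 by rewrite -enorm_gt0 v1.
have Ea : eigenvalue N a.
  apply/eigenvalueP; exists v^T; last by rewrite trmx_eq0.
  by rewrite -[N in LHS]sN -trmx_mul Nv linearZ.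
have lba : lbound [set b | eigenvalue N b] a.
  move=> b /= /eigenvalueP[u uN u0].
  have := vmin u^T.
  rewrite /qform trmxK uN -scalemxAl mxE.
  have -> : (u *m u^T) ord0 ord0 = enorm u^T ^+ 2.
    by rewrite -qform1 /qform trmxK mulmx1.
  by rewrite ler_pM2r// exprn_gt0// enorm_gt0 trmx_eq0.
apply/eqP; rewrite eq_le; apply/andP; split.
  by apply: ge_inf => //; exists a.
by apply: lb_le_inf => //; exists a.
Qed.

(** Negation reverses the spectrum, and [inf] is itself defined from [sup] by negation. This carries
    every fact on the least eigenvalue over to the largest one. *)
Lemma eigmaxE (R : realType) (n : nat) (N : 'M[R]_n) :
  eigmax N = - eigmin (- N).
Proof.
rewrite /eigmax /eigmin /inf opprK; congr sup.
apply/seteqP; split => [a /= /eigenvalueP[v vN v0]|].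
  exists (- a); rewrite ?opprK//; apply/eigenvalueP; exists v => //.
  by rewrite mulmxN vN scaleNr.
move=> _ [a /= /eigenvalueP[v vN v0] <-]; apply/eigenvalueP; exists v => //.
by rewrite -[N]opprK mulmxN vN scaleNr.
Qed.

Lemma qform_eigenvector (R : realType) (n : nat) (N : 'M[R]_n) (c : R)
    (v : 'cV[R]_n) : N *m v = c *: v -> qform N v = c * enorm v ^+ 2.
Proof.
by move=> Nv; rewrite -qform1 /qform mulmx1 -mulmxA Nv -scalemxAr mxE.
Qed.

Lemma eigmin_le_qform (R : realType) (n : nat) (N : 'M[R]_n) (v : 'cV[R]_n) :
  (0 < n)%N -> symmx N -> eigmin N * enorm v ^+ 2 <= qform N v.
Proof. by move=> n0 sN; have [u [_ _]] := eigmin_attained n0 sN; exact. Qed.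

Lemma symmxN (R : realType) (n : nat) (N : 'M[R]_n) : symmx N -> symmx (- N).
Proof. by move=> sN; rewrite /symmx linearN /= sN. Qed.

Lemma symmx_sum (R : realType) (n : nat) (I : finType) (N : I -> 'M[R]_n) :
  (forall i, symmx (N i)) -> symmx (\sum_i N i).
Proof.
by move=> sN; rewrite /symmx linear_sum; apply: eq_bigr => i _; exact: sN.
Qed.

Lemma qform_le_eigmax (R : realType) (n : nat) (N : 'M[R]_n) (v : 'cV[R]_n) :
  (0 < n)%N -> symmx N -> qform N v <= eigmax N * enorm v ^+ 2.
Proof.
move=> n0 sN; rewrite eigmaxE mulNr lerNr -qformN.
by apply: eigmin_le_qform => //; exact: symmxN.
Qed.

Lemma eigmin_le_eigmax (R : realType) (n : nat) (N : 'M[R]_n) :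
  (0 < n)%N -> symmx N -> eigmin N <= eigmax N.
Proof.
move=> n0 sN; have [v [v1 _ _]] := eigmin_attained n0 sN.
have := le_trans (eigmin_le_qform v n0 sN) (qform_le_eigmax v n0 sN).
by rewrite v1 expr1n !mulr1.
Qed.

Lemma eigmin_gt0 (R : realType) (n : nat) (N : 'M[R]_n) :
  (0 < n)%N -> posdefmx N -> 0 < eigmin N.
Proof.
move=> n0 [sN N0]; have [v [v1 Nv _]] := eigmin_attained n0 sN.
have := N0 v; rewrite -enorm_gt0 v1 => /(_ ltr01).
by rewrite (qform_eigenvector Nv) v1 expr1n mulr1.
Qed.

(** The unit eigenvector of one matrix is a test vector for the other: if v belongs to [eigmin B],
    then [eigmin A] is at most [qform A v], which is [eigmin B] plus [qform (A - B) v]. *)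
Lemma eigmin_lipschitz (R : realType) (n : nat) (N N' : 'M[R]_n) :
  (0 < n)%N -> symmx N -> symmx N' ->
  `|eigmin N - eigmin N'| <= n%:R * `|N - N'|.
Proof.
move=> n0.
suff h (A B : 'M[R]_n) : symmx A -> symmx B ->
    eigmin A - eigmin B <= n%:R * `|A - B|.
  move=> sN sN'; rewrite ler_norml h// andbT.
  by have := h _ _ sN' sN; rewrite distrC; lra.
move=> sA sB; have [v [v1 Bv _]] := eigmin_attained n0 sB.
have qB : qform B v = eigmin B.
  by rewrite (qform_eigenvector Bv) v1 expr1n mulr1.
have := eigmin_le_qform v n0 sA; rewrite v1 expr1n mulr1.
have := qformD (A - B) B v; rewrite subrK qB => -> hA.
have := le_trans (ler_norm _) (qform_norm_le (A - B) v).
rewrite v1 expr1n mulr1; lra.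
Qed.

Lemma eigmin_within_continuous (R : realType) (T : topologicalType) (D : set T)
    (n : nat) (N : T -> 'M[R]_n) : (0 < n)%N ->
  (forall t, D t -> symmx (N t)) -> {within D, continuous N} ->
  {within D, continuous (fun t => eigmin (N t))}.
Proof.
move=> n0 sN /subspace_continuousP cN; apply/subspace_continuousP => t Dt.
apply/cvgrPdist_lt => e e0.
have n1 : 0 < n%:R :> R by rewrite ltr0n.
have e1 : 0 < e / n%:R by rewrite divr_gt0.
have /cvgrPdist_lt/(_ _ e1) := cN _ Dt.
rewrite !near_withinE; apply: filterS => s Ns Ds.
rewrite (le_lt_trans (eigmin_lipschitz n0 (sN _ Dt) (sN _ Ds)))//.
by rewrite mulrC -ltr_pdivlMr// Ns.
Qed.

(** * Differential inequalities with finitely many exceptional times *)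

(** Induction on the exceptional points: an interior one splits the interval, and continuity there
    lets the two inequalities be chained. The base case is the mean value theorem. *)
Lemma le_of_derive_le0 (R : realType) (f : R -> R) (E : seq R) (a b : R) :
  a <= b -> {within `[a, b], continuous f} ->
  (forall t, t \in `]a, b[ -> t \notin E ->
     derivable f t 1 /\ 'D_1 f t <= 0) ->
  f b <= f a.
Proof.
elim: E a b => [|e E IH] a b ab cf df.
  have dfx t : t \in `]a, b[ -> is_derive t 1 f ('D_1 f t).
    by move=> tab; apply: derivableP; have [] := df t tab isT.
  move: ab; rewrite le_eqVlt => /predU1P[->//|ltab].
  have [c cab fE] := MVT ltab dfx cf.
  rewrite -subr_le0 fE mulr_le0_ge0 ?subr_ge0 ?(ltW ltab)//.
  by have [] := df c cab isT.
have [eab|eab] := boolP (e \in `]a, b[); last first.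
  apply: IH => // t tab tE; apply: df => //; rewrite inE negb_or tE andbT.
  by apply: contraNneq eab => <-.
move: eab; rewrite in_itv/= => /andP[ae eb].
apply: (@le_trans _ _ (f e)); apply: IH; rewrite ?ltW//.
- apply: continuous_subspaceW cf => t /=; rewrite !in_itv/= => /andP[h ->].
  by rewrite andbT (le_trans _ h)// ltW.
- move=> t; rewrite !in_itv/= => /andP[et tb] tE; apply: df.
    by rewrite in_itv/= tb andbT (lt_trans ae).
  by rewrite inE negb_or tE andbT gt_eqF.
- apply: continuous_subspaceW cf => t /=; rewrite !in_itv/= => /andP[-> h].
  by rewrite (le_trans h)// ltW.
- move=> t; rewrite !in_itv/= => /andP[et tb] tE; apply: df.
    by rewrite in_itv/= et (lt_trans tb).
  by rewrite inE negb_or tE andbT lt_eqF.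
Qed.

Lemma is_derive_expR_mul (R : realType) (k : R) (f : R -> R) (df t : R) :
  is_derive t 1 f df ->
  is_derive t 1 (fun s => expR (k * s) * f s) (expR (k * t) * (k * f t + df)).
Proof.
move=> fdf.
have dk : is_derive t 1 (fun s : R => k * s) k.
  have h := @is_deriveZ _ _ _ id k t 1 1 (is_derive_id _ _).
  by apply: (is_derive_eq h); rewrite /GRing.scale /= mulr1.
have de : is_derive t 1 (fun s => expR (k * s)) (expR (k * t) * k).
  exact: (is_derive1_comp (is_derive_expR _) dk).
apply: (is_derive_eq (is_deriveM de fdf)).
rewrite /GRing.scale /=; ring.
Qed.

Lemma expR_mul_within_continuous (R : realType) (k : R) (D : set R)
    (f : R -> R) : {within D, continuous f} ->
  {within D, continuous (fun s => expR (k * s) * f s)}.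
Proof.
move=> cf t; apply: cvgM; last exact: cf.
apply: (@continuous_subspaceT _ _ D (fun s => expR (k * s))) => s.
apply: (@continuous_comp _ _ _ (fun s : R => k * s)).
  exact: mulrl_continuous.
exact: continuous_expR.
Qed.

(** Gronwall's inequality, with integrating factor exp(k t). *)
Lemma exp_decay (R : realType) (f : R -> R) (E : seq R) (k a b : R) :
  a <= b -> {within `[a, b], continuous f} ->
  (forall t, t \in `]a, b[ -> t \notin E ->
     derivable f t 1 /\ 'D_1 f t <= - k * f t) ->
  f b <= expR (- k * (b - a)) * f a.
Proof.
move=> ab cf df.
have : expR (k * b) * f b <= expR (k * a) * f a.
  apply: (@le_of_derive_le0 _ (fun s => expR (k * s) * f s) E) => //.
    exact: expR_mul_within_continuous.
  move=> t tab tE; have [dft Dft] := df t tab tE.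
  have h := is_derive_expR_mul k (derivableP dft).
  split; first by case: h.
  rewrite (@derive_val _ _ _ _ _ _ _ h) pmulr_rle0 ?expR_gt0//; lra.
rewrite -ler_pdivlMl ?expR_gt0// -expRN mulrA -expRD.
by rewrite (_ : - (k * b) + k * a = - k * (b - a))//; ring.
Qed.

Lemma is_derive_qform (R : realType) (n : nat) (N : R -> 'M[R]_n)
    (y : R -> 'cV[R]_n) (t : R) : derivable N t 1 -> derivable y t 1 ->
  is_derive t 1 (fun s => qform (N s) (y s))
    (qform ('D_1 N t) (y t) + (('D_1 y t)^T *m N t *m y t) ord0 ord0
     + ((y t)^T *m N t *m 'D_1 y t) ord0 ord0).
Proof.
move=> dN dy; have /derivable_mxP dNe := dN; have /derivable_mxP dye := dy.
(* As a sum of products of scalar functions, the form has a derivative that instance resolution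
   assembles by the product rule. *)
have -> : (fun s => qform (N s) (y s))
    = \sum_j \sum_i ((fun s => y s i ord0) * (fun s => N s i j)
        * (fun s => y s j ord0)).
  apply/funext => s; rewrite qformE fct_sumE; apply: eq_bigr => j _.
  by rewrite fct_sumE.
have dye' i := derivableP (dye i ord0); have dNe' i j := derivableP (dNe i j).
apply: is_derive_eq.
rewrite (derive_mx dN) (derive_mx dy) qformE.
rewrite [X in _ = _ + X + _]mxE [X in _ = _ + _ + X]mxE -!big_split/=.
apply: eq_bigr => j _; rewrite !mxE !mulr_suml -!big_split/=.
apply: eq_bigr => i _; rewrite !mxE.
rewrite [X in X *: _](_ : _ = y t i ord0 * N t i j)//.
rewrite /GRing.scale /=; ring.
Qed.

(** * Positivity of P by a backward argument *)

Lemma notin_right (R : realType) (E : seq R) (c : R) :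
  exists2 e, 0 < e & forall t, c < t < c + e -> t \notin E.
Proof.
elim: E => [|x E [e e0 he]]; first by exists 1.
have [cx|xc] := ltP c x.
  exists (Num.min e (x - c)); first by rewrite lt_min e0 subr_gt0.
  move=> t /andP[ct]; rewrite -ltrBlDl lt_min => /andP[te tx].
  rewrite inE negb_or he ?andbT; last by rewrite ct -ltrBlDl.
  by rewrite lt_eqF//; lra.
exists e => // t /andP[ct te]; rewrite inE negb_or he ?ct//.
by rewrite gt_eqF// (le_lt_trans xc).
Qed.

(* At a minimum c < b of exp (k t) * eigmin (P t) with eigmin (P c) <= 0, take a
   unit eigenvector v of P c. Then exp (k t) * qform (P t) v lies above that
   minimum for t > c and meets it at c, whereas its derivative right of c is
   close to exp (k c) times
   eigmin (P c) * (k - 2 v^T F v) - v^T W v <= - lambda < 0. *)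
Lemma lyapunov_posdef (R : realType) (n : nat) (P F W : R -> 'M[R]_n)
    (E : seq R) (a b lambda K : R) : (0 < n)%N -> a <= b ->
  {within `[a, b], continuous P} -> (forall t, t \in `[a, b] -> symmx (P t)) ->
  (forall t, t \in `]a, b[ -> t \notin E -> derivable P t 1 /\
     'D_1 P t = - (P t *m F t + (F t)^T *m P t) - W t) ->
  0 <= K -> (forall t, t \in `]a, b[ -> `|F t| <= K) -> 0 < lambda ->
  (forall t v, t \in `]a, b[ -> lambda * enorm v ^+ 2 <= qform (W t) v) ->
  posdefmx (P b) ->
  forall t, t \in `[a, b] -> 0 < eigmin (P t).
Proof.
move=> n0 ab cP sP dP K0 bF l0 bW Pb.
(* For unit v, the form of F is at most n K, so k - 2 v^T F v >= 0; multiplied by an eigenvalue that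
   is <= 0, it contributes nothing positive. *)
pose k := 2 * n%:R * K.
have nR : 0 < n%:R :> R by rewrite ltr0n.
have cm : {within `[a, b], continuous (fun t => expR (k * t) * eigmin (P t))}.
  by apply: expR_mul_within_continuous; exact: eigmin_within_continuous.
have [c cab cmin] := EVT_min ab cm.
suff mc : 0 < eigmin (P c).
  move=> t tab; rewrite -(pmulr_rgt0 _ (expR_gt0 (k * t))).
  by rewrite (lt_le_trans _ (cmin t tab))// mulr_gt0// expR_gt0.
rewrite ltNge; apply/negP => mc.
have cb : c < b.
  move: cab; rewrite in_itv/= lt_neqAle => /andP[_ ->]; rewrite andbT.
  by apply: contraTneq mc => ->; rewrite -ltNge; exact: eigmin_gt0.
have ac : a <= c by move: cab; rewrite in_itv/= => /andP[].
have [v [v1 Pv _]] := eigmin_attained n0 (sP _ cab).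
pose mu := eigmin (P c).
have qv : qform (P c) v = mu.
  by rewrite (qform_eigenvector Pv) v1 expr1n mulr1.
(* Total cost of replacing P t by P c in the derivative, per unit of [|P t - P c|]: n k from k v^T P
   v and 2 n^2 K from 2 v^T P F v. The final 1 makes C positive, so that lambda / C is
   meaningful. *)
pose C := n%:R * k + 2 * n%:R * n%:R * K + 1.
have k0 : 0 <= k by rewrite !mulr_ge0// ltW.
have C0 : 0 < C.
  have : 0 <= n%:R * k by rewrite mulr_ge0// ltW.
  have : 0 <= 2 * n%:R * n%:R * K by rewrite !mulr_ge0// ltW.
  by rewrite /C; lra.
have [e1 /= e10 Pe1] : exists2 e, 0 < e &
    forall t, c < t < c + e -> t <= b -> `|P t - P c| < lambda / C.
  move/subspace_continuousP : cP => /(_ c cab)/cvgrPdist_lt.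
  move=> /(_ _ (divr_gt0 l0 C0)); rewrite near_withinE => -[e /= e0 he].
  exists e => // t /andP[ct te] tb; rewrite distrC; apply: he => /=.
    by rewrite distrC ger0_norm; lra.
  by rewrite in_itv/= tb andbT; lra.
have [e2 e20 Ee2] := notin_right E c.
(* On the open interval from c to d, P is within lambda / C of P c, no exceptional time occurs, and
   b is not passed. *)
pose d := c + Num.min (b - c) (Num.min e1 e2).
have m0 : 0 < Num.min (b - c) (Num.min e1 e2).
  by rewrite !lt_min e10 e20 subr_gt0 cb.
have cd : c < d by rewrite ltrDl.
have db : d <= b by rewrite -lerBrDl ge_min lexx.
have de1 : d <= c + e1 by rewrite lerD2l !ge_min lexx orbT.
have de2 : d <= c + e2 by rewrite lerD2l !ge_min lexx !orbT.
pose dg t := expR (k * t) * (k * qform (P t) v + qform ('D_1 P t) v).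
have near_c t : t \in `]c, d[ -> [/\ t \in `]a, b[, t \notin E &
    `|P t - P c| < lambda / C].
  rewrite !in_itv/= => /andP[ct td]; split.
  - by apply/andP; split; lra.
  - by apply: Ee2; rewrite ct; lra.
  - by apply: Pe1; [rewrite ct/=|]; lra.
have isdg t : t \in `]c, d[ ->
    is_derive t 1 (fun s => expR (k * s) * qform (P s) v) (dg t).
  move=> /near_c[tab tE _]; have [dPt _] := dP t tab tE.
  apply: is_derive_expR_mul.
  apply: (is_derive_eq (is_derive_qform dPt (derivable_cst v t 1))).
  by rewrite derive_cst trmx0 !mul0mx mulmx0 !mxE !addr0.
have cg : {within `[c, d], continuous (fun s => expR (k * s) * qform (P s) v)}.
  apply: expR_mul_within_continuous; apply: qform_within_continuous.
    apply: continuous_subspaceW cP => t /=; rewrite !in_itv/= => /andP[ct td].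
    by apply/andP; split; lra.
  exact/continuous_subspaceT/cst_continuous.
have [t tcd gE] := MVT cd isdg cg.
have gcd : expR (k * c) * qform (P c) v <= expR (k * d) * qform (P d) v.
  have dab : d \in `[a, b] by rewrite in_itv/= db andbT; lra.
  rewrite qv (le_trans (cmin d dab))// ler_pM2l ?expR_gt0//.
  by have := eigmin_le_qform v n0 (sP _ dab); rewrite v1 expr1n mulr1.
have : 0 <= dg t by rewrite -(pmulr_lge0 _ (_ : 0 < d - c)) ?subr_gt0// -gE subr_ge0.
rewrite /dg pmulr_rge0 ?expR_gt0//; apply/negP; rewrite -ltNge.
have [tab tE Pt] := near_c t tcd.
have [_ ->] := dP t tab tE.
have -> : qform (- (P t *m F t + (F t)^T *m P t) - W t) v
    = - 2 * qform (P t *m F t) v - qform (W t) v.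
  rewrite qformD !qformN qformD -(qform_trmx (_^T *m _)) trmx_mul trmxK.
  rewrite sP; first by ring.
  by move: tab; rewrite !in_itv/= => /andP[? ?]; rewrite !ltW.
have -> : qform (P t) v = mu + qform (P t - P c) v by rewrite qformD qformN qv; ring.
have -> : qform (P t *m F t) v = mu * qform (F t) v + qform ((P t - P c) *m F t) v.
  rewrite mulmxBl qformD qformN.
  (* Since P c is symmetric and v is its eigenvector, v^T P c = mu v^T. *)
  suff -> : qform (P c *m F t) v = mu * qform (F t) v by ring.
  rewrite /qform mulmxA -{1}(sP _ cab) -trmx_mul Pv linearZ /=.
  by rewrite -!scalemxAl mxE.
have nF := bF t tab.
have := le_trans (ler_norm _) (qform_norm_le (P t - P c) v).
have := le_trans (ler_norm _) (qform_norm_le (- ((P t - P c) *m F t)) v).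
have := le_trans (ler_norm _) (qform_norm_le (F t) v).
have := bW t v tab.
rewrite !v1 !expr1n !mulr1 normrN qformN.
have hM := mulmx_norm_le (P t - P c) (F t).
set D := `|P t - P c| in Pt hM *.
set M := `|_ *m _| in hM *.
set qW := qform (W t) v; set qF := qform (F t) v.
set qDF := qform (_ *m _) v; set qD := qform _ v.
move=> hW hF hDF hD.
have D0 : 0 <= D by exact: normr_ge0.
have h1 : mu * (k - 2 * qF) <= 0.
  rewrite mulr_le0_ge0// subr_ge0 /k -mulrA ler_pM2l// (le_trans hF)//.
  by rewrite ler_pM2l.
have h2 : k * qD <= D * (n%:R * k).
  by rewrite (_ : D * _ = k * (n%:R * D)) ?ler_wpM2l//; ring.
have h3 : 2 * - qDF <= D * (2 * n%:R * n%:R * K).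
  have h : M <= n%:R * (D * K).
    by rewrite (le_trans hM)// ler_pM2l// ler_wpM2l.
  have h' : n%:R * M <= n%:R * (n%:R * (D * K)) by rewrite ler_pM2l.
  rewrite (_ : D * _ = 2 * (n%:R * (n%:R * (D * K)))); last by ring.
  by rewrite ler_pM2l// (le_trans hDF).
have h4 : D * C < lambda by rewrite -ltr_pdivlMr.
(* The derivative, up to its positive factor, is at most 0 + D (C - 1) - lambda, which is negative
   because D C < lambda. *)
move: h1 h2 h3 h4 hW; rewrite /C; nra.
Qed.

(** * Eigenvalue extrema over the interval and decay of the trajectory *)

Lemma eigmin_overE (R : realType) (n : nat) (a b : R) (N : R -> 'M[R]_n)
    (t : R) : t \in `[a, b] ->
  (forall s, s \in `[a, b] -> eigmin (N t) <= eigmin (N s)) ->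
  eigmin_over a b N = eigmin (N t).
Proof.
move=> tab tmin.
have lb : lbound [set eigmin (N s) | s in `[a, b]] (eigmin (N t)).
  by move=> _ [s /= sab <-]; exact: tmin.
apply/eqP; rewrite eq_le; apply/andP; split.
  by apply: ge_inf; [exists (eigmin (N t))|exists t].
by apply: lb_le_inf => //; exists (eigmin (N t)), t.
Qed.

Lemma eigmax_overE (R : realType) (n : nat) (a b : R) (N : R -> 'M[R]_n)
    (t : R) : t \in `[a, b] ->
  (forall s, s \in `[a, b] -> eigmax (N s) <= eigmax (N t)) ->
  eigmax_over a b N = eigmax (N t).
Proof.
move=> tab tmax.
have ub : ubound [set eigmax (N s) | s in `[a, b]] (eigmax (N t)).
  by move=> _ [s /= sab <-]; exact: tmax.
apply/eqP; rewrite eq_le; apply/andP; split.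
  by apply: ge_sup => //; exists (eigmax (N t)), t.
by apply: ub_le_sup; [exists (eigmax (N t))|exists t].
Qed.

Lemma eigmin_over_attained (R : realType) (n : nat) (a b : R)
    (N : R -> 'M[R]_n) : (0 < n)%N -> a <= b ->
  {within `[a, b], continuous N} -> (forall t, t \in `[a, b] -> symmx (N t)) ->
  exists2 t, t \in `[a, b] & eigmin_over a b N = eigmin (N t) /\
    forall s, s \in `[a, b] -> eigmin (N t) <= eigmin (N s).
Proof.
move=> n0 ab cN sN.
have [t tab tmin] := EVT_min ab (eigmin_within_continuous n0 sN cN).
by exists t => //; split => //; exact: eigmin_overE.
Qed.

Lemma eigmax_over_attained (R : realType) (n : nat) (a b : R)
    (N : R -> 'M[R]_n) : (0 < n)%N -> a <= b ->
  {within `[a, b], continuous N} -> (forall t, t \in `[a, b] -> symmx (N t)) ->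
  exists2 t, t \in `[a, b] & eigmax_over a b N = eigmax (N t) /\
    forall s, s \in `[a, b] -> eigmax (N s) <= eigmax (N t).
Proof.
move=> n0 ab cN sN.
have cNN : {within `[a, b], continuous (fun t => - N t)}.
  by move=> t; apply: continuousN => s; exact: cN.
have sNN t : t \in `[a, b] -> symmx (- N t) by move=> tab; apply/symmxN/sN.
have [t tab tmin] := EVT_min ab (eigmin_within_continuous n0 sNN cNN).
have tmax s : s \in `[a, b] -> eigmax (N s) <= eigmax (N t).
  by move=> sab; rewrite !eigmaxE lerN2 tmin.
by exists t => //; split => //; exact: eigmax_overE.
Qed.

(** V lies between [lmin] and [lmax] times the squared norm. The upper bound converts the loss
    lambda |x|^2 into a rate for V; passing from the norm to V at time a and back at time t costs
    [lmax / lmin]. *)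
Lemma lyapunov_decay (R : realType) (n : nat) (P F W : R -> 'M[R]_n)
    (x : R -> 'cV[R]_n) (E : seq R) (a b lambda : R) : (0 < n)%N -> a <= b ->
  {within `[a, b], continuous P} -> (forall t, t \in `[a, b] -> symmx (P t)) ->
  (forall t, t \in `]a, b[ -> t \notin E -> derivable P t 1 /\
     'D_1 P t = - (P t *m F t + (F t)^T *m P t) - W t) ->
  {within `[a, b], continuous x} ->
  (forall t, t \in `]a, b[ -> t \notin E -> derivable x t 1 /\
     'D_1 x t = F t *m x t) ->
  0 < lambda ->
  (forall t v, t \in `]a, b[ -> lambda * enorm v ^+ 2 <= qform (W t) v) ->
  (forall t, t \in `[a, b] -> 0 < eigmin (P t)) ->
  let lmax := eigmax_over a b P in
  let lmin := eigmin_over a b P in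
  [/\ 0 < lmin, 0 < lmax & forall t, t \in `[a, b] ->
    enorm (x t) ^+ 2
    <= lmax / lmin * expR (- (lambda / lmax) * (t - a)) * enorm (x a) ^+ 2].
Proof.
move=> n0 ab cP sP dP cx dx l0 bW P0 lmax lmin.
have [t1 t1ab [lminE minP]] := eigmin_over_attained n0 ab cP sP.
have [t2 t2ab [lmaxE maxP]] := eigmax_over_attained n0 ab cP sP.
have lmin0 : 0 < lmin by rewrite /lmin lminE P0.
have lmax0 : 0 < lmax.
  by rewrite /lmax lmaxE (lt_le_trans (P0 _ t2ab))//; apply/eigmin_le_eigmax/sP.
have Ple t v : t \in `[a, b] -> qform (P t) v <= lmax * enorm v ^+ 2.
  move=> tab; rewrite (le_trans (qform_le_eigmax _ n0 (sP _ tab)))//.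
  by rewrite ler_wpM2r ?sqr_ge0// /lmax lmaxE maxP.
have Pge t v : t \in `[a, b] -> lmin * enorm v ^+ 2 <= qform (P t) v.
  move=> tab; rewrite (le_trans _ (eigmin_le_qform _ n0 (sP _ tab)))//.
  by rewrite ler_wpM2r ?sqr_ge0// /lmin lminE minP.
split => // t tab.
have aab : a \in `[a, b] by rewrite in_itv/= lexx.
move: (tab); rewrite in_itv/= => /andP[at_ tb].
have cxP : {within `[a, t], continuous (fun s => qform (P s) (x s))}.
  have sub : `[a, t] `<=` `[a, b].
    by move=> s /=; rewrite !in_itv/= => /andP[-> /le_trans]; exact.
  by apply: qform_within_continuous; exact: (continuous_subspaceW sub).
have dxP s : s \in `]a, t[ -> s \notin E ->
    derivable (fun s => qform (P s) (x s)) s 1 /\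
    'D_1 (fun s => qform (P s) (x s)) s
    <= - (lambda / lmax) * qform (P s) (x s).
  move=> + sE; rewrite in_itv/= => /andP[as_ st].
  have sab : s \in `]a, b[ by rewrite in_itv/= as_ (lt_le_trans st).
  have sab' : s \in `[a, b].
    by rewrite in_itv/= (ltW as_) ltW// (lt_le_trans st).
  have [dPs DPs] := dP s sab sE; have [dxs Dxs] := dx s sab sE.
  have h := is_derive_qform dPs dxs; split; first by case: h.
  rewrite (@derive_val _ _ _ _ _ _ _ h) DPs Dxs qformD !qformN qformD.
  rewrite trmx_mul !mulmxA -(mulmxA _ (F s)^T) -(mulmxA _ (P s) (F s)).
  rewrite -!/(qform _ _).
  (* The terms in F from P' cancel those from the two occurrences of x'. *)
  rewrite (_ : _ + _ = - qform (W s) (x s)); last by ring.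
  rewrite mulNr lerN2 (le_trans _ (bW s _ sab))//.
  by rewrite -mulrA ler_pM2l// ler_pdivrMl// Ple.
have := exp_decay at_ cxP dxP.
have := Pge t (x t) tab; have := Ple a (x a) aab.
set e := expR _; set N := enorm (x t) ^+ 2; set N0 := enorm (x a) ^+ 2.
move=> h1 h2 h3.
rewrite -(ler_pM2l lmin0) (le_trans h2)// (le_trans h3)//.
rewrite (_ : lmin * _ = e * (lmax * N0)); last by field; rewrite gt_eqF.
by rewrite ler_pM2l// expR_gt0.
Qed.

(** * The closed loop of the game *)

Lemma bounded_on_le (R : realType) (T : Type) (V : normedModType R)
    (f : T -> V) (D : set T) : [bounded f t | t in D] ->
  exists2 C, 0 <= C & forall t, D t -> `|f t| <= C.
Proof.
move=> [C [_ hC]]; exists (`|C| + 1); first by rewrite addr_ge0.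
move=> t Dt; apply: hC => //.
by rewrite (le_lt_trans (ler_norm _))// ltrDl.
Qed.

Lemma within_continuous_bounded (R : realType) (V : normedModType R)
    (f : R -> V) (a b : R) : a <= b -> {within `[a, b], continuous f} ->
  exists2 C, 0 <= C & forall t, t \in `[a, b] -> `|f t| <= C.
Proof.
move=> ab cf.
have cn : {within `[a, b], continuous (fun t => `|f t|)}.
  by move=> t; apply: cvg_norm; exact: cf.
have [c cab cmax] := EVT_max ab cn.
by exists `|f c|.
Qed.

Lemma posdefmx_unit (R : realType) (n : nat) (N : 'M[R]_n) :
  posdefmx N -> N \in unitmx.
Proof.
move=> [_ N0]; rewrite -row_free_unit -kermx_eq0; apply/eqP/row_matrixP => i.
rewrite row0; apply/eqP/contraT => k0.
have := N0 (row i (kermx N))^T; rewrite trmx_eq0 => /(_ k0).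
by rewrite /qform trmxK -row_mul mulmx_ker row0 mul0mx mxE ltxx.
Qed.

Lemma posdefmx_ge0 (R : realType) (n : nat) (N : 'M[R]_n) (v : 'cV[R]_n) :
  posdefmx N -> 0 <= qform N v.
Proof.
move=> [_ N0]; have [->|/N0/ltW//] := eqVneq v 0.
by rewrite /qform mulmx0 mxE.
Qed.

(** The inverse of a symmetric N is congruent to N through itself. *)
Lemma posdefmx_inv_ge0 (R : realType) (n : nat) (N : 'M[R]_n) (v : 'cV[R]_n) :
  posdefmx N -> 0 <= qform (invmx N) v.
Proof.
move=> pN; have -> : invmx N = (invmx N)^T *m N *m invmx N.
  by rewrite trmx_inv pN.1 mulVmx ?mul1mx// posdefmx_unit.
by rewrite qform_mul posdefmx_ge0.
Qed.

Definition closed_loop_mx (R : realType) (M n : nat) (m : 'I_M -> nat)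
    (G : lq_game R n m) (S : 'I_M -> R -> 'M[R]_n) (t : R) : 'M[R]_n :=
  dynA G t - \sum_(j < M) gameH G j t *m S j t.

Definition closed_loop_weight (R : realType) (M n : nat) (m : 'I_M -> nat)
    (G : lq_game R n m) (S : 'I_M -> R -> 'M[R]_n) (t : R) : 'M[R]_n :=
  \sum_(i < M) (wgtQ G i t + S i t *m gameH G i t *m S i t).

Lemma gameH_sym (R : realType) (M n : nat) (m : 'I_M -> nat)
    (G : lq_game R n m) i t :
  symmx (wgtR G i t) -> symmx (gameH G i t).
Proof. by move=> sR; rewrite /symmx !trmx_mul trmxK trmx_inv sR mulmxA. Qed.

Lemma qform_gameH_ge0 (R : realType) (M n : nat) (m : 'I_M -> nat)
    (G : lq_game R n m) i t v :
  posdefmx (wgtR G i t) -> 0 <= qform (gameH G i t) v.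
Proof.
move=> pR; rewrite /gameH -{1}(trmxK (inpB G i t)) qform_mul.
exact: posdefmx_inv_ge0.
Qed.

Lemma closed_loop_riccati (R : realType) (M n : nat) (m : 'I_M -> nat)
    (hM : (2 <= M)%N) (G : lq_game R n m) (S : 'I_M -> R -> 'M[R]_n) :
  is_AAO_game hM G -> riccati_solution G S ->
  exists E : seq R, forall t, t \in `]tini G, tfin G[ -> t \notin E ->
    derivable (fun t => \sum_i S i t) t 1 /\
    'D_1 (fun t => \sum_i S i t) t
    = - ((\sum_i S i t) *m closed_loop_mx G S t
         + (closed_loop_mx G S t)^T *m \sum_i S i t)
      - closed_loop_weight G S t.
Proof.
move=> hG hS; have [E hE] := ric_eq hS; exists E => t tab tE.
have tab' : t \in `[tini G, tfin G] by apply: subset_itv_oo_cc.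
have -> : (fun t => \sum_i S i t) = \sum_i S i.
  by apply/funext => s; rewrite fct_sumE.
have dS i : derivable (S i) t 1 by have [] := hE t tab tE i.
split; first exact: derivable_sum.
rewrite derive_sum//.
rewrite mulmx_suml mulmx_sumr -big_split /closed_loop_weight /= -!sumrN -big_split/=.
(* Symmetry of H_j and S_j turns (H_j S_j)^T into S_j H_j, the second half of the coupling terms. *)
have FT : (closed_loop_mx G S t)^T
    = (dynA G t)^T - \sum_j S j t *m gameH G j t.
  rewrite /closed_loop_mx [LHS]linearB /= [(\sum_j _)^T]linear_sum /=.
  congr (_ - _); apply: eq_bigr => j _; have [sR _] := aao_Rpos hG j tab'.
  by rewrite trmx_mul gameH_sym// (ric_sym hS).
apply: eq_bigr => i _; have [_ e] := hE t tab tE i; move: e.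
rewrite FT /closed_loop_mx mulmxBr mulmxBl mulmx_sumr mulmx_suml big_split /=.
have -> : \sum_j S i t *m (gameH G j t *m S j t)
    = \sum_j S i t *m gameH G j t *m S j t.
  by apply: eq_bigr => j _; rewrite mulmxA.
set SA := S i t *m dynA G t; set AS := _^T *m S i t.
set SHS := S i t *m gameH G i t *m S i t.
set s1 := \sum_j _; set s2 := \sum_j _; set D := 'D_1 _ t; move=> e.
(* With the matrix products as atoms, each entry of the identity for player i follows linearly from
   the Riccati equation. *)
apply/matrixP => k l.
have := congr1 (fun X : 'M[R]_n => X k l) e; rewrite !mxE; lra.
Qed.

(** Supplies the constant K of the positivity argument: A and the H_i are bounded by assumption, the
    S_i by continuity on a compact interval. *)
Lemma closed_loop_mx_bounded (R : realType) (M n : nat) (m : 'I_M -> nat)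
    (hM : (2 <= M)%N) (G : lq_game R n m) (S : 'I_M -> R -> 'M[R]_n) :
  is_AAO_game hM G -> riccati_solution G S ->
  exists2 K, 0 <= K &
    forall t, t \in `[tini G, tfin G] -> `|closed_loop_mx G S t| <= K.
Proof.
move=> hG hS; have ab := ltW (aao_time hG).
have [KA KA0 hA] := bounded_on_le (aao_A hG).1.
have bHS i : exists K : R, 0 <= K /\ forall t, t \in `[tini G, tfin G] ->
    `|gameH G i t *m S i t| <= K.
  have [KH KH0 hH] := bounded_on_le (aao_H hG i).
  have cS := @ric_cont _ _ _ _ _ _ hS i.
  have [KS KS0 hS'] := within_continuous_bounded ab cS.
  exists (n%:R * (KH * KS)); split; first by rewrite !mulr_ge0.
  move=> t tab; rewrite (le_trans (mulmx_norm_le _ _))// ler_wpM2l//.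
  by rewrite ler_pM ?hH ?hS'.
have [K hK] := choice bHS.
exists (KA + \sum_i K i).
  by rewrite addr_ge0// sumr_ge0// => i _; have [] := hK i.
move=> t tab; rewrite (le_trans (ler_normB _ _))// lerD ?hA//.
rewrite (le_trans (ler_norm_sum _ _ _))// ler_sum// => i _.
by have [_] := hK i; apply.
Qed.

Lemma qform_closed_loop_weight_ge (R : realType) (M n : nat) (m : 'I_M -> nat)
    (hM : (2 <= M)%N) (G : lq_game R n m) (S : 'I_M -> R -> 'M[R]_n) t v :
  is_AAO_game hM G -> riccati_solution G S -> t \in `[tini G, tfin G] ->
  qform (\sum_i wgtQ G i t) v <= qform (closed_loop_weight G S t) v.
Proof.
move=> hG hS tab; rewrite /closed_loop_weight big_split /= qformD lerDl.
rewrite qform_sum sumr_ge0// => i _.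
rewrite -{1}(ric_sym hS i tab) qform_mul qform_gameH_ge0//.
exact: (aao_Rpos hG).
Qed.

Unset Implicit Arguments.

Theorem theorem3 (R : realType) (M n : nat) (m : 'I_M -> nat)
    (hM : (2 <= M)%N) (G : lq_game R n m) (hG : is_AAO_game hM G)
    (S : 'I_M -> R -> 'M[R]_n) (hS : riccati_solution G S)
    (hQatt : eig_extrema_attained (tini G) (tfin G)
               (fun t => \sum_(i < M) wgtQ G i t))
    (hQ : forall t, t \in `[tini G, tfin G] ->
       posdefmx (wgtQ G (player1 hM) t
                 + \sum_(i < M | i != player1 hM) wgtQ G i t))
    (hSf : posdefmx (trmS G (player1 hM)
                     + \sum_(i < M | i != player1 hM) trmS G i))
    (x : R -> 'cV[R]_n) (hx : closed_loop_trajectory G S x) :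
  let P := fun t => S (player1 hM) t
                    + \sum_(i < M | i != player1 hM) S i t in
  let Qhat := fun t => \sum_(i < M) wgtQ G i t in
  let lmaxP := eigmax_over (tini G) (tfin G) P in
  let lminP := eigmin_over (tini G) (tfin G) P in
  let lminQ := eigmin_over (tini G) (tfin G) Qhat in
  exp_bounded (tini G) (tfin G) x /\
  forall r : R, 0 < r ->
    lmaxP / lminQ * (2 * ln (enorm (xini G) / r) + ln (lmaxP / lminP))
      <= tfin G - tini G ->
    enorm (x (tfin G)) <= r.
Proof.
move=> P Qhat lmaxP lminP lminQ.
(* In dimension 0 the initial state would vanish; eigenvectors exist only in positive dimension. *)
have n0 : (0 < n)%N.
  rewrite lt0n; apply: contra_neqN (aao_xini hG) => /eqP n0.
  by apply/colP => i; have := ltn_ord i; rewrite {2}n0.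
have ab := ltW (aao_time hG).
have PE t : P t = \sum_i S i t by rewrite (bigD1 (player1 hM)).
have QE t : Qhat t = wgtQ G (player1 hM) t
    + \sum_(i < M | i != player1 hM) wgtQ G i t.
  by rewrite /Qhat (bigD1 (player1 hM)).
have pQ t : t \in `[tini G, tfin G] -> posdefmx (Qhat t).
  by move=> tab; rewrite QE; exact: hQ.
have [_ [tQ tQab tQmin]] := hQatt.
have lminQE : lminQ = eigmin (Qhat tQ) by exact: eigmin_overE.
have lminQ0 : 0 < lminQ by rewrite lminQE; exact/eigmin_gt0/pQ.
have sub t : t \in `]tini G, tfin G[ -> t \in `[tini G, tfin G].
  exact: subset_itv_oo_cc.
have bW t v : t \in `]tini G, tfin G[ ->
    lminQ * enorm v ^+ 2 <= qform (closed_loop_weight G S t) v.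
  move=> /sub tab; have := qform_closed_loop_weight_ge v hG hS tab.
  apply: le_trans.
  rewrite (le_trans _ (eigmin_le_qform v n0 (pQ t tab).1))//.
  by rewrite ler_wpM2r ?sqr_ge0// lminQE tQmin.
have PEf : P = fun t => \sum_i S i t by apply/funext.
have cP : {within `[tini G, tfin G], continuous P}.
  rewrite PEf; apply: continuous_big => [|i _]; first exact: add_continuous.
  exact: (ric_cont hS).
have sP t : t \in `[tini G, tfin G] -> symmx (P t).
  by move=> tab; rewrite PE; apply: symmx_sum => i; exact: (ric_sym hS).
have [E1 dP] := closed_loop_riccati hG hS; rewrite -PEf in dP.
have [E2 dx] := traj_ode hx.
have [K K0 hK] := closed_loop_mx_bounded hG hS.
have pPf : posdefmx (P (tfin G)).
  rewrite /P (ric_final hS).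
  by under eq_bigr do rewrite (ric_final hS).
have P0 := lyapunov_posdef (E := E1) n0 ab cP sP _ K0
  (fun t h => hK t (sub t h)) lminQ0 bW pPf.
have {}P0 : forall t, t \in `[tini G, tfin G] -> 0 < eigmin (P t).
  by apply: P0 => t tab tE; rewrite PE; exact: dP.
have := @lyapunov_decay R n P (closed_loop_mx G S) (closed_loop_weight G S) x
  (E1 ++ E2) (tini G) (tfin G) lminQ n0 ab cP sP _ (traj_cont hx) _
  lminQ0 bW P0.
rewrite -/lmaxP -/lminP => -[].
- move=> t tab; rewrite mem_cat negb_or => /andP[tE _].
  by rewrite PE; exact: dP.
- by move=> t tab; rewrite mem_cat negb_or => /andP[_]; exact: dx.
move=> lminP0 lmaxP0 decay.
have q0 : 0 < lmaxP / lminP by rewrite divr_gt0.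
have k0 : 0 < lminQ / lmaxP by rewrite divr_gt0.
split.
  (* Square roots of the constants in the decay of the squared norm. *)
  exists (Num.sqrt (lmaxP / lminP)), (lminQ / lmaxP / 2); split.
  - by rewrite sqrtr_gt0.
  - by rewrite divr_gt0.
  move=> t tab; rewrite -(@ler_pXn2r _ 2)// ?nnegrE ?enorm_ge0//; last first.
    by rewrite !mulr_ge0 ?sqrtr_ge0 ?expR_ge0 ?enorm_ge0.
  rewrite !exprMn (sqr_sqrtr (ltW q0)) -expRM_natl (le_trans (decay t tab))//.
  rewrite (_ : 2%:R * _ = - (lminQ / lmaxP) * (t - tini G))//.
  by field; rewrite gt_eqF.
move=> r r0 hT.
have bab : tfin G \in `[tini G, tfin G] by rewrite in_itv/= ab lexx.
have x00 : 0 < enorm (xini G) by rewrite enorm_gt0; exact: aao_xini hG.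
have xr : 0 < enorm (xini G) / r by rewrite divr_gt0.
rewrite -(@ler_pXn2r _ 2)// ?nnegrE ?enorm_ge0 ?(ltW r0)//.
rewrite (le_trans (decay _ bab))// (traj_init hx).
(* The time condition, multiplied by lminQ / lmaxP and exponentiated, says that (|x0| / r)^2 lmaxP /
   lminP is at most the growth factor, that is, that the decay bound at the final time is at most
   r^2. *)
have : expR (2 * ln (enorm (xini G) / r) + ln (lmaxP / lminP))
    <= expR (lminQ / lmaxP * (tfin G - tini G)).
  rewrite ler_expR; have := hT; rewrite -(ler_pM2l k0) mulrA.
  rewrite (_ : lminQ / lmaxP * (lmaxP / lminQ) = 1) ?mul1r//.
  by field; rewrite !gt_eqF.
rewrite expRD expRM_natl !lnK ?posrE// (mulNr (lminQ / lmaxP)) expRN => h.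
rewrite mulrAC ler_pdivrMr ?expR_gt0// mulrC.
rewrite -ler_pdivrMl ?exprn_gt0//.
by apply: le_trans h; rewrite [leLHS]mulrC [leLHS]mulrAC expr_div_n.
Qed.
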